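(* Every right-reducible TRS has UNC.
   Context: A TRS is a finite set of rewrite rules $l\to r$ ($l\notin\mathcal{V}$, $\mathcal{V}(r)\subseteq\mathcal{V}(l)$); $\mathrm{NF}(\mathcal{R})$ is its set of normal forms. $\mathcal{R}$ has UNC if $s\stackrel{*}{\leftrightarrow}_{\mathcal{R}}t$ and $s,t\in\mathrm{NF}(\mathcal{R})$ imply $s=t$. $\mathcal{R}$ is right-reducible if $r\notin\mathrm{NF}(\mathcal{R})$ for every rule $l\to r\in\mathcal{R}$. *)

(* Defs.v *)
From Stdlib Require List.
From Stdlib Require Import Relation_Operators.
From mathcomp Require Import all_boot.

Set Implicit Arguments.
Unset Strict Implicit.
Unset Printing Implicit Defensive.

(* [F] is the set of function symbols, with arities [ar]; the countably
   infinite set of variables is [nat]. *)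
Inductive term (F : Type) (ar : F -> nat) : Type :=
| Var of nat
| App f of {ffun 'I_(ar f) -> term ar}.

Arguments Var {F ar} x.
Arguments App {F ar} f ts.

Fixpoint occurs (F : Type) (ar : F -> nat) (x : nat) (t : term ar) : bool :=
  match t with
  | Var y => x == y
  | App f ts => [exists i, occurs x (ts i)]
  end.

Fixpoint subst (F : Type) (ar : F -> nat) (sigma : nat -> term ar)
    (t : term ar) : term ar :=
  match t with
  | Var x => sigma x
  | App f ts => App f [ffun i => subst sigma (ts i)]
  end.

(* [CApp f i ts C] is the context f(ts_0, ..., C, ..., ts_(n-1)) with [C] at
   argument position [i]; the entry [ts i] is a dummy, ignored by [fill]. *)
Inductive context (F : Type) (ar : F -> nat) : Type :=
| Hole
| CApp f of 'I_(ar f) & {ffun 'I_(ar f) -> term ar} & context ar.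

Arguments Hole {F ar}.
Arguments CApp {F ar} f i ts C.

Fixpoint fill (F : Type) (ar : F -> nat) (C : context ar) (t : term ar) :
    term ar :=
  match C with
  | Hole => t
  | CApp f i ts C' =>
      App f [ffun j => if j == i then fill C' t else ts j]
  end.

Record rule (F : Type) (ar : F -> nat) : Type := Rule {
  lhs : term ar;
  rhs : term ar;
  lhs_nonvar : forall x, lhs <> Var x;
  rhs_vars : forall x, occurs x rhs -> occurs x lhs
}.

(* A finite set of rules, given by an enumeration. *)
Definition trs (F : Type) (ar : F -> nat) : Type := seq (rule ar).

Definition rstep (F : Type) (ar : F -> nat) (R : trs ar) (s t : term ar) :
    Prop :=
  exists (rl : rule ar) (C : context ar) (sigma : nat -> term ar),
    [/\ List.In rl R,
        s = fill C (subst sigma (lhs rl))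
      & t = fill C (subst sigma (rhs rl))].

Definition NF (F : Type) (ar : F -> nat) (R : trs ar) (t : term ar) : Prop :=
  ~ exists u, rstep R t u.

Definition conversion (F : Type) (ar : F -> nat) (R : trs ar) :
    term ar -> term ar -> Prop :=
  clos_refl_sym_trans (term ar) (rstep R).

Definition UNC (F : Type) (ar : F -> nat) (R : trs ar) : Prop :=
  forall s t, conversion R s t -> NF R s -> NF R t -> s = t.

Definition right_reducible (F : Type) (ar : F -> nat) (R : trs ar) : Prop :=
  forall rl, List.In rl R -> ~ NF R (rhs rl).

(* Main.v *)
(* Rewriting is closed under substitutions and contexts, so reducibility of the
   right-hand sides makes the target of every step reducible, as its source is
   trivially. Hence a normal form is isolated in the conversion graph. *)
Require Import Defs.
From mathcomp Require Import all_boot.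

Lemma subst_subst (F : Type) (ar : F -> nat) (sigma tau : nat -> term ar)
    (t : term ar) :
  subst sigma (subst tau t) = subst (fun x => subst sigma (tau x)) t.
Proof.
(* The arguments of [App] sit inside a finite function, so the structural induction is a direct
   fixpoint whose hypothesis is used at each [ts i]. *)
move: t; fix IH 1; case=> [x|f ts] //=.
by congr App; apply/ffunP => i; rewrite !ffunE; apply: IH.
Qed.

Fixpoint subst_context (F : Type) (ar : F -> nat) (sigma : nat -> term ar)
    (C : context ar) : context ar :=
  match C with
  | Hole => Hole
  | CApp f i ts D =>
      CApp f i [ffun j => subst sigma (ts j)] (subst_context F ar sigma D)
  end.

Arguments subst_context {F ar} sigma C.

Lemma subst_fill (F : Type) (ar : F -> nat) (sigma : nat -> term ar)
    (C : context ar) (t : term ar) :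
  subst sigma (fill C t) = fill (subst_context sigma C) (subst sigma t).
Proof.
elim: C => //= f i ts D IH; congr App; apply/ffunP => j; rewrite !ffunE.
by case: ifP.
Qed.

Fixpoint comp_context (F : Type) (ar : F -> nat) (C D : context ar) :
    context ar :=
  match C with
  | Hole => D
  | CApp f i ts C' => CApp f i ts (comp_context F ar C' D)
  end.

Arguments comp_context {F ar} C D.

Lemma fill_comp (F : Type) (ar : F -> nat) (C D : context ar) (t : term ar) :
  fill (comp_context C D) t = fill C (fill D t).
Proof. by elim: C => //= f i ts C ->. Qed.

(** The same rule fires in the instantiated context, its matching substitution [tau] being followed
    by [sigma]. *)
Lemma rstep_subst (F : Type) (ar : F -> nat) (R : trs ar)
    (sigma : nat -> term ar) (s t : term ar) :
  rstep R s t -> rstep R (subst sigma s) (subst sigma t).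
Proof.
case=> rl [C] [tau] [Rrl -> ->].
exists rl, (subst_context sigma C), (fun x => subst sigma (tau x)).
by rewrite !subst_fill !subst_subst.
Qed.

Lemma rstep_fill (F : Type) (ar : F -> nat) (R : trs ar) (C : context ar)
    (s t : term ar) :
  rstep R s t -> rstep R (fill C s) (fill C t).
Proof.
case=> rl [D] [sigma] [Rrl -> ->].
by exists rl, (comp_context C D), sigma; rewrite !fill_comp.
Qed.

(** The target contains an instance of some [rhs rl], and a step from [rhs rl] lifts through that
    instance and its context. *)
Lemma right_reducible_rstep (F : Type) (ar : F -> nat) (R : trs ar)
    (s t : term ar) :
  right_reducible R -> rstep R s t -> ~ NF R t.
Proof.
move=> redR [rl] [C] [sigma] [Rrl _ ->] nf; apply: (redR rl Rrl) => -[u ru].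
by apply: nf; exists (fill C (subst sigma u)); apply/rstep_fill/rstep_subst.
Qed.

Theorem theorem7 (F : Type) (ar : F -> nat) (R : trs ar) :
  right_reducible R -> UNC R.
Proof.
move=> redR s t st nfs _.
(* One normal end must suffice, since the middle term of a transitivity is not known to be normal;
   having both directions lets symmetry swap them. *)
suff: (NF R s -> s = t) /\ (NF R t -> s = t) by case=> /(_ nfs).
elim: st => {s t nfs} [s t st|//|s t _ [IHs IHt]|s t u _ [IHs IHt] _ [IHt' IHu]].
- split=> nf; first by case: nf; exists t.
  by case: (right_reducible_rstep _ _ _ _ _ redR st).
- by split=> nf; [rewrite IHt | rewrite IHs].
(* The half with the normal end identifies that end with the middle term, which is thus normal and
   starts the other half. *)
- by split=> nf; [have e := IHs nf | have e := IHu nf]; subst t; auto.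
Qed.
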